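(* Let $F$ be a $4$-regular graph. Then the Eulerian $3$-matroid $Q(F)$ has a strict, totally transversally unimodular representation.
   Context: Graphs may have loops and multiple edges; they are given by vertices, half-edges, a partition of half-edges into pairs (edges), and an incidence map from half-edges to vertices. $c(F)$ is the number of connected components. $F$ is $4$-regular if every vertex is incident with exactly $4$ half-edges. A single transition is an unordered pair of distinct half-edges at a common vertex; a transition at $v$ is a partition of the four half-edges at $v$ into two single transitions; $\mathfrak T(F)$ is the set of all transitions, and a transversal of $\mathfrak T(F)$ contains exactly one transition at each vertex. A circuit (closed trail, possibly repeating vertices, using each half-edge at most once) passes through a vertex via single transitions; a circuit partition $P$ is a set of circuits such that every half-edge lies in exactly one single transition of exactly one circuit of $P$, and $\tau(P)$ is the set of transitions both of whose single transitions occur in circuits of $P$; every transversal of $\mathfrak T(F)$ equals $\tau(P)$ for a unique $P$. Multimatroids: for a partition $\Omega$ of a finite set $U$ (skew classes), a transversal meets every skew class in exactly one element; a subtransversal is a subset of a transversal. A multimatroid $(U,\Omega,r)$ has $r$ from subtransversals to $\mathbb N$ such that on each subtransversal $S$, $r$ is a matroid rank function, and for $x\ne y$ in a skew class disjoint from $S$, $\max\{r(S\cup\{x\}),r(S\cup\{y\})\}>r(S)$. A representation is a matrix with columns indexed by $U$ such that the rank of the columns in any subtransversal $S$ equals $r(S)$; it is strict if the matrix rank equals $\max r$. The Eulerian $3$-matroid $Q(F)$ is the unique multimatroid $(\mathfrak T(F),\Omega,r)$ whose skew classes are the sets of three transitions at each vertex and with $r(\tau(P))=|V(F)|-(|P|-c(F))$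 for every circuit partition $P$. A real $X\times\mathfrak T(F)$ matrix is totally transversally unimodular if for every transversal $T$ of $\mathfrak T(F)$, its submatrix of columns in $T$ is totally unimodular (every square submatrix has determinant in $\{-1,0,1\}$). *)

(* Defs.v *)
From HB Require Import structures.
From mathcomp Require Import all_boot all_order all_algebra.
From mathcomp Require Import Rstruct.
From Stdlib Require Rdefinitions.
Notation R := Rdefinitions.R.

Set Implicit Arguments.
Unset Strict Implicit.
Unset Printing Implicit Defensive.

Import GRing.Theory Num.Theory.
Local Open Scope ring_scope.

(* A graph F (loops and multiple edges allowed) is given by a finite vertex
   type V, a finite half-edge type H, an incidence map [inc : H -> V] and the
   partition of H into pairs (edges), encoded as a fixed-point-free involution
   [opp : H -> H] (opp h is the other half of the edge containing h). *)

Section Graph.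
Variables (V H : finType) (inc : H -> V) (opp : H -> H).

Definition hes (v : V) : {set H} := [set h | inc h == v].

Definition four_regular : Prop := forall v : V, #|hes v| = 4%N.

Definition vadj : rel V := fun u w => [exists h, (inc h == u) && (inc (opp h) == w)].
Definition ncomp_graph : nat := n_comp (vadj) V.

Definition single_transition (s : {set H}) : bool :=
  (#|s| == 2)%N && [exists v, s \subset hes v].

Definition trans_at (v : V) (P : {set {set H}}) : bool :=
  [&& partition P (hes v), #|P| == 2%N & [forall s in P, single_transition s]].

Definition is_transition (P : {set {set H}}) : bool := [exists v, trans_at v P].

Definition transition := {P : {set {set H}} | is_transition P}.

Definition at_v (v : V) (t : transition) : bool := trans_at v (val t).

Definition subtransv (S : {set transition}) : bool :=
  [forall v : V, #|[set t in S | at_v v t]| <= 1]%N.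

Definition transv (S : {set transition}) : bool :=
  [forall v : V, #|[set t in S | at_v v t]| == 1]%N.

(* The circuits of the circuit partition P with tau(P) = T: the connected
   components of the 2-regular structure on half-edges whose adjacencies are
   the edges (h ~ opp h) and the single transitions used in T. *)
Definition circ_rel (T : {set transition}) : rel H :=
  fun h k => (opp h == k) ||
             [exists t in T, [set h; k] \in val t].
Definition ncircuits (T : {set transition}) : nat := n_comp (circ_rel T) H.

Definition multimatroid (r : {set transition} -> nat) : Prop :=
  (forall S : {set transition}, subtransv S ->
     (forall A : {set transition}, A \subset S -> (r A <= #|A|)%N) /\
     (forall A B : {set transition}, A \subset B -> B \subset S -> (r A <= r B)%N) /\
     (forall A B : {set transition}, A \subset S -> B \subset S ->
        (r (A :|: B) + r (A :&: B) <= r A + r B)%N)) /\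
  (forall (S : {set transition}) (v : V) (x y : transition), subtransv S -> [set t in S | at_v v t] = set0 ->
     at_v v x -> at_v v y -> x != y ->
     (r S < maxn (r (x |: S)) (r (y |: S)))%N).

Definition is_eulerian_3matroid (r : {set transition} -> nat) : Prop :=
  multimatroid r /\
  forall T : {set transition}, transv T ->
    Posz (r T) = (Posz #|V| - (Posz (ncircuits T) - Posz ncomp_graph) : int).

End Graph.
Arguments is_eulerian_3matroid {V H} inc opp r.

Definition colmx (U : finType) (m : nat) (M : 'I_m -> U -> R) (S : {set U})
  : 'M[R]_(m, #|S|) := \matrix_(i < m, j < #|S|) M i (@enum_val U (mem S) j).

Definition totally_unimodular (m n : nat) (A : 'M[R]_(m, n)) : Prop :=
  forall (k : nat) (f : 'I_k -> 'I_m) (g : 'I_k -> 'I_n),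
    injective f -> injective g ->
    let d := \det (\matrix_(i < k, j < k) A (f i) (g j)) in
    d = -1 \/ d = 0 \/ d = 1.

(* Main.v *)
Require Import Defs.
From HB Require Import structures.
From mathcomp Require Import all_boot all_order all_algebra.
From mathcomp Require Import Rstruct.
From mathcomp Require Import zify.

Set Implicit Arguments.
Unset Strict Implicit.
Unset Printing Implicit Defensive.

Import GRing.Theory.
Local Open Scope ring_scope.

(** A flow on F is a function f on half-edges with f (opp h) = - f h and sum zero
    at every vertex.  A transition {s, s'} defines, up to sign, the functional
    f |-> f(s) = \sum_(h in s) f h on flows.  For a circuit partition P the
    flows killed by all transitions of \tau(P) are spanned by the circuits of
    P, so on the flows vanishing on one chosen edge of each component these
    functionals have rank |V| - (|P| - c(F)), and flows of this kind form a
    space of dimension |V|.  In the basis of fundamental cycles of a spanning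
    forest the matrix of these functionals is a Schur complement of the
    incidence matrix of F extended by the rows of \tau(P), which differs by row
    operations from a network matrix; hence it is totally unimodular on every
    transversal.  Ranks are computed from left kernels, i.e. from functions
    that are constant on components; the role of the omitted edges and the
    nondegeneracy of the multimatroid are parity arguments. *)

(** * Network matrices, Schur complements and determinants in {-1, 0, 1} *)

Section LinearAlgebra.
Variable K : fieldType.

(** The condition on minors is carried throughout as [d ^+ 3 = d], which is stable under products
    and under cancelling a nonzero factor of the same kind; in a field it factors as d (d - 1) (d +
    1) = 0. *)
Lemma cube_eq_self (d : K) : d ^+ 3 = d -> d = -1 \/ d = 0 \/ d = 1.
Proof.
move=> h; have: d * ((d - 1) * (d + 1)) = 0.
  by rewrite -subr_sqr expr1n mulrBr mulr1 -exprS h subrr.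
move/eqP; rewrite !mulf_eq0 subr_eq0 addr_eq0 => /or3P[] /eqP; auto.
Qed.

(* A column with both ends in the [s i] sums to zero, so unless all columns
   are of this kind some column has at most one nonzero entry. *)
Lemma det_network (H : finType) (n : nat) (s : 'I_n -> {set H})
    (a b : 'I_n -> H) :
  (forall h i j, h \in s i -> h \in s j -> i = j) ->
  let d := \det (\matrix_(i, j) ((a j \in s i)%:R - (b j \in s i)%:R : K)) in
  d ^+ 3 = d.
Proof.
elim: n s a b => [|n IHn] s a b dis; first by rewrite /= det_mx00 expr1n.
set N := (X in \det X); move=> d; rewrite {}/d.
(* Expansion along such a column gives zero or, up to sign, [e] times a smaller determinant of the
   same form. *)
have step (j : 'I_n.+1) (h : H) (e : K) : e ^+ 3 = e ->
    (forall i, N i j = e * (h \in s i)%:R) -> \det N ^+ 3 = \det N.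
  move=> e3 Nj; rewrite (expand_det_col N j).
  have [i0 hi0|hN] := pickP (fun i => h \in s i); last first.
    rewrite big1 ?expr0n // => i _; by rewrite Nj hN mulr0 mul0r.
  rewrite (bigD1 i0) //= big1 ?addr0 => [|i ne]; last first.
    rewrite Nj; case: (boolP (h \in s i)) => [hi|_]; last by rewrite mulr0 mul0r.
    by rewrite (dis _ _ _ hi hi0) eqxx in ne.
  rewrite Nj hi0 mulr1 /cofactor !exprMn e3 -exprM mulnC exprM.
  have -> : ((-1) ^+ 3 : K) = -1 by rewrite !exprS expr0 mulr1 mulrNN mulN1r mulr1.
  congr (_ * (_ * _)).
  have := IHn (s \o lift i0) (a \o lift j) (b \o lift j).
  have -> : row' i0 (col' j N) = \matrix_(i, j0)
      (((a \o lift j) j0 \in (s \o lift i0) i)%:R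
       - ((b \o lift j) j0 \in (s \o lift i0) i)%:R).
    by apply/matrixP=> i k; rewrite !mxE.
  apply=> h' i k /dis h1 /h1 /lift_inj; exact.
have [j /existsPn aj|nj] := pickP (fun j => ~~ [exists i, a j \in s i]).
  apply: (step j (b j) (-1)) => [|i].
    by rewrite !exprS expr0 mulr1 mulrNN mulN1r mulr1.
  by rewrite mxE (negPf (aj i)) sub0r mulN1r.
have [j /existsPn bj|nj'] := pickP (fun j => ~~ [exists i, b j \in s i]).
  apply: (step j (a j) 1) => [|i]; first by rewrite expr1n.
  by rewrite mxE (negPf (bj i)) subr0 mul1r.
suff -> : \det N = 0 by rewrite expr0n.
apply/eqP/det0P; exists (const_mx 1).
  by apply/eqP=> /matrixP/(_ 0 0)/eqP; rewrite !mxE oner_eq0.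
apply/rowP=> j; rewrite !mxE.
have sum1 h : [exists i, h \in s i] -> \sum_i (h \in s i)%:R = 1 :> K.
  case/existsP=> i hi; rewrite (bigD1 i) //= hi big1 ?addr0 // => k ki.
  by case: (boolP (h \in s k)) => // /dis/(_ hi) ki'; rewrite ki' eqxx in ki.
under eq_bigr do rewrite !mxE mul1r.
by rewrite sumrB !sum1 ?subrr //; apply/negbNE; rewrite ?nj ?nj'.
Qed.

(* [Q] is the projection of the row space that makes [P *m Q] the Schur
   complement of a maximal invertible submatrix of [B]. *)
Lemma schur_projection (n q : nat) (B : 'M[K]_(n, q)) : exists Q : 'M[K]_q,
  (forall p (P : 'M[K]_(p, q)),
     (\rank (P *m Q) + \rank B)%N = \rank (col_mx B P)) /\
  (forall p (P : 'M[K]_(p, q)),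
     (forall r k (f : 'I_r -> 'I_n) (f' : 'I_k -> 'I_p) (g : 'I_(r + k) -> 'I_q),
        injective f -> injective f' ->
        let d := \det (colsub g (col_mx (rowsub f B) (rowsub f' P))) in
        d ^+ 3 = d) ->
     forall k (f : 'I_k -> 'I_p) (g : 'I_k -> 'I_q), injective f ->
       let d := \det (mxsub f g (P *m Q)) in d ^+ 3 = d).
Proof.
pose f0 := maxrankfun B; pose Br := rowsub f0 B.
have full : row_full Br^T.
  by rewrite /row_full mxrank_tr (eq_maxrowsub B).
pose g0 := fullrankfun full; pose A := colsub g0 Br.
have uA : A \in unitmx.
  by rewrite -unitmx_tr /A trmx_mxsub fullrowsub_unit.
pose J : 'M[K]_(q, _) := colsub g0 1%:M.
have BJ : Br *m J = A by rewrite mulmx_colsub mulmx1.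
(* [P *m Q] subtracts from each row of [P] the combination of rows of [Br] that clears the columns
   [g0]. *)
pose Q := 1%:M - J *m invmx A *m Br.
have QJ : Q *m J = 0.
  by rewrite mulmxBl mul1mx -(mulmxA _ Br J) BJ mulmxKV ?subrr.
exists Q; split=> p P => [|TU k f g injf].
  have PQ : P *m Q = P - P *m J *m invmx A *m Br by rewrite mulmxBr mulmx1 !mulmxA.
  have sPQ : (P - P *m Q <= Br)%MS by rewrite PQ subKr submxMl.
  have -> : \rank (col_mx B P) = \rank (Br + P *m Q)%MS.
    rewrite -addsmxE; apply/eqmx_rank/andP; split.
      rewrite addsmx_sub (submx_trans _ (addsmxSl _ _)) ?eq_maxrowsub //=.
      rewrite -[X in (X <= _)%MS](subrK (P *m Q)).
      by rewrite addmx_sub ?addsmxSr // (submx_trans sPQ) ?addsmxSl.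
    rewrite addsmx_sub (submx_trans _ (addsmxSl _ _)) ?eq_maxrowsub //=.
    rewrite PQ addmx_sub ?addsmxSr // eqmx_opp (submx_trans _ (addsmxSl _ _)) //.
    by rewrite (submx_trans (submxMl _ _)) ?eq_maxrowsub.
  (* A common row [x *m Br] vanishes on the columns [g0], where it equals [x *m A]; hence [x] is
     zero. *)
  rewrite mxrank_disjoint_sum; first by rewrite addnC /Br eq_maxrowsub.
  apply/eqP; rewrite -submx0; apply/rV_subP=> v; rewrite sub_capmx.
  case/andP=> /submxP[x ->] /submxP[y e].
  have : x *m A = 0 by rewrite -BJ mulmxA e -!mulmxA QJ !mulmx0.
  move/(congr1 (fun z => z *m invmx A)); rewrite mulmxK // mul0mx => ->.
  by rewrite mul0mx sub0mx.
(* By the Schur formula this product is the determinant of the stacked matrix on rows [f0], [f'] and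
   columns [g0], [g']. These columns may repeat, which is why column selections are arbitrary
   maps. *)
have X k' (f' : 'I_k' -> 'I_p) (g' : 'I_k' -> 'I_q) : injective f' ->
    let d := \det A * \det (mxsub f' g' (P *m Q)) in d ^+ 3 = d.
  move=> injf'.
  pose col' := fun i : 'I_(\rank B + k') => match split i with inl a => g0 a | inr b => g' b end.
  have := TU _ _ f0 f' col' (@maxrankfun_inj _ _ _ B) injf'.
  have -> : colsub col' (col_mx (rowsub f0 B) (rowsub f' P)) =
     block_mx A (colsub g' Br) (mxsub f' g0 P) (mxsub f' g' P).
    apply/matrixP=> i j; rewrite mxE.
    rewrite -[i]splitK -[j]splitK; case: (split i) => i'; case: (split j) => j' /=;
    rewrite ?block_mxEul ?block_mxEur ?block_mxEdl ?block_mxEdr ?col_mxEu ?col_mxEd;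
    by rewrite /col' (unsplitK (inl _)) || rewrite /col' (unsplitK (inr _)); rewrite !mxE.
  set Xm := block_mx _ _ _ _.
  (* Unimodular column operations clear the upper right block. *)
  have : Xm *m block_mx 1%:M (- (invmx A *m colsub g' Br)) 0 1%:M =
      block_mx A 0 (mxsub f' g0 P) (mxsub f' g' (P *m Q)).
    rewrite mulmx_block !mulmx0 !mulmx1 !addr0 mulmxN mulKVmx // addNr.
    congr block_mx; rewrite mulmxN addrC mulmxBr mulmx1 !mulmxA.
    rewrite /J (mulmx_colsub g0 P) mulmx1 raddfB /= mxsub_mul -mul_rowsub_mx.
    by rewrite -mxsubrc.
  move/(congr1 determinant); rewrite det_mulmx det_ublock det_lblock !det1 !mulr1.
  by move=> ->.
have i0 (T : Type) : 'I_0 -> T by case.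
have A3 : \det A ^+ 3 = \det A.
  have := X _ (i0 'I_p) (i0 'I_q) ltac:(by case).
  by rewrite /= det_mx00 mulr1.
have := X _ f g injf; rewrite /= exprMn A3.
by move/mulfI; apply; rewrite -unitfE -unitmxE.
Qed.

End LinearAlgebra.

(** * Ranks and connected components *)

(** Through the injective map [Phi], the left kernel of [X] is the space of functions constant on
    the components of [e]; its dimension is their number. *)
Lemma rank_components (K : fieldType) (U : finType) (e : rel U) (n m : nat)
    (X : 'M[K]_(n, m)) (Phi : 'M[K]_(n, #|U|)) :
  connect_sym e -> row_free Phi ->
  (forall x : 'rV_n, x *m X = 0 <->
     forall u w, e u w ->
       (x *m Phi) 0 (enum_rank u) = (x *m Phi) 0 (enum_rank w)) ->
  (forall z : 'rV_#|U|,
     (forall u w, e u w -> z 0 (enum_rank u) = z 0 (enum_rank w)) ->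
     (z <= Phi)%MS) ->
  (\rank X + n_comp e U)%N = n.
Proof.
move=> sym_e freePhi kerX imPhi.
pose C : pred U := [predI fingraph.roots e & U].
(* The rows of [N] are the indicators of the components; [J] restricts a function to the roots, one
   per component. *)
pose N : 'M[K]_(#|C|, #|U|) :=
  \matrix_(i, j) (fingraph.root e (enum_val j) == enum_val i)%:R.
pose J : 'M[K]_(#|U|, #|C|) := \matrix_(j, i) (enum_val j == enum_val i)%:R.
have mulJ p (z : 'M[K]_(p, #|U|)) k i :
    (z *m J) k i = z k (enum_rank (enum_val i)).
  rewrite mxE (bigD1 (enum_rank (enum_val i))) //= mxE enum_rankK eqxx mulr1.
  rewrite big1 ?addr0 // => j nj; rewrite mxE; case: eqP => [ji|_].
    by rewrite -ji enum_valK eqxx in nj.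
  by rewrite mulr0.
have freeN : row_free N.
  apply/row_freeP; exists J; apply/matrixP=> i i'; rewrite mulJ !mxE enum_rankK.
  have /andP[/eqP-> _] : C (enum_val i') by apply: (enum_valP i').
  by rewrite (inj_eq enum_val_inj) eq_sym.
have constN (z : 'rV_#|U|) :
    (forall u w, e u w -> z 0 (enum_rank u) = z 0 (enum_rank w)) -> (z <= N)%MS.
  move=> cz; have czc u w : connect e u w -> z 0 (enum_rank u) = z 0 (enum_rank w).
    by move/connectP=> [p]; elim: p u => [u _ ->|v p IH u /andP[/cz-> /IH]].
  suff -> : z = z *m J *m N by apply: submxMl.
  apply/rowP=> j; set u := enum_val j; rewrite mxE.
  have Cr : fingraph.root e u \in C by apply/andP; split=> //; apply: roots_root.
  pose i0 := enum_rank_in Cr (fingraph.root e u).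
  have i0E : enum_val i0 = fingraph.root e u := enum_rankK_in Cr Cr.
  rewrite (bigD1 i0) //= mulJ mxE i0E eqxx mulr1 -(czc u) ?connect_root //.
  rewrite enum_valK big1 ?addr0 // => i ni; rewrite mulJ !mxE.
  case: eqP => [e1|_]; last by rewrite mulr0.
  by rewrite -(inj_eq enum_val_inj) i0E -e1 eqxx in ni.
have Nconst u w i : e u w -> N i (enum_rank u) = N i (enum_rank w).
  move=> /connect1 euw; rewrite !mxE !enum_rankK; congr ((_ == _)%:R).
  by apply/eqP; rewrite root_connect.
have -> : n_comp e U = \rank N by rewrite (eqP freeN); apply: eq_card.
have -> : \rank N = \rank (kermx X *m Phi).
  apply/eqmx_rank/andP; split.
    apply/row_subP=> i; have /submxP[x xE] : (row i N <= Phi)%MS.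
      by apply: imPhi => u w euw; rewrite [LHS]mxE [RHS]mxE (Nconst u w).
    rewrite xE submxMr //; apply/sub_kermxP/kerX => u w euw; rewrite -xE.
    by rewrite [LHS]mxE [RHS]mxE (Nconst u w).
  apply/row_subP=> i; rewrite row_mul; apply/constN/kerX.
  by apply/sub_kermxP; rewrite row_sub.
by rewrite mxrankMfree // mxrank_ker subnKC ?rank_leq_row.
Qed.

(** * Transitions, and multimatroids determined by their transversals *)

Section Transitions.
Variables (V H : finType) (inc : H -> V).
Hypothesis F4 : four_regular inc.
Implicit Types (S T : {set transition inc}) (t x y : transition inc) (v w : V).

(** An arbitrary choice between the two single transitions of [t]; the other one defines the negated
    functional on flows. The default [set0] never occurs. *)
Definition block t : {set H} := odflt set0 [pick s in val t].

Lemma at_v_exists t : exists v, at_v v t.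
Proof. exact/existsP/(valP t). Qed.

Lemma at_v_blocks v t : at_v v t ->
  [/\ block t \subset hes inc v, #|block t| = 2%N &
      val t = [set block t; hes inc v :\: block t]].
Proof.
case/and3P=> /and3P[/eqP cov triv nil] /cards2P[s1 [s2 [ne E]]] /forall_inP st.
have bt : block t \in val t.
  rewrite /block; case: pickP => // /(_ s1); by rewrite E !inE eqxx.
have sb : block t \subset hes inc v by rewrite -cov; apply: bigcup_sup bt.
split=> //; first by have /andP[/eqP] := st _ bt.
have U : hes inc v = s1 :|: s2.
  by rewrite -cov E /cover bigcup_setU !big_set1.
have D : s1 :&: s2 = set0.
  by apply/eqP; rewrite setI_eq0; apply: (trivIsetP triv); rewrite ?E ?inE ?eqxx ?orbT.
move: bt; rewrite {1}E !inE => /orP[] /eqP ->; rewrite E U setDUl setDv ?set0U ?setU0.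
  by congr [set _; _]; apply/esym/setDidPl; rewrite disjoint_sym -setI_eq0 D.
rewrite setUC; congr [set _; _]; apply/esym/setDidPl; by rewrite -setI_eq0 D.
Qed.

Lemma at_v_inj v w t : at_v v t -> at_v w t -> v = w.
Proof.
move=> /at_v_blocks[sv c _] /at_v_blocks[sw _ _].
have /set0Pn[h hb] : block t != set0 by rewrite -cards_eq0 c.
by move: (subsetP sv _ hb) (subsetP sw _ hb); rewrite !inE => /eqP <- /eqP.
Qed.

Lemma block_inc v t h : at_v v t -> h \in block t -> inc h = v.
Proof. by move=> /at_v_blocks[/subsetP sv _ _] /sv; rewrite inE => /eqP. Qed.

Lemma block_at t h : h \in block t -> at_v (inc h) t.
Proof. by have [v tv] := at_v_exists t => /(block_inc tv) ->. Qed.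

(** Two pairs in a set of four that coincide or are disjoint define the same partition into
    pairs. *)
Lemma card_blockI v x y :
  at_v v x -> at_v v y -> x != y -> #|block x :&: block y| = 1%N.
Proof.
move=> /at_v_blocks[sx cx Ex] /at_v_blocks[sy cy Ey] ne.
have : (#|block x :&: block y| <= 2)%N by rewrite -cx subset_leq_card ?subsetIl.
rewrite leq_eqVlt => /orP[/eqP c2|].
  case/negP: ne; apply/eqP/val_inj; rewrite Ex Ey.
  have e1 : block x :&: block y = block x by apply/eqP; rewrite eqEcard subsetIl cx c2.
  have e2 : block x :&: block y = block y by apply/eqP; rewrite eqEcard subsetIr cy c2.
  by rewrite -e1 e2.
rewrite ltnS leq_eqVlt => /orP[/eqP//|]; rewrite ltnS leqn0 cards_eq0 => dis.
case/negP: ne; apply/eqP/val_inj; rewrite Ex Ey.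
have -> : block y = hes inc v :\: block x.
  apply/eqP; rewrite eqEcard subsetD sy disjoint_sym -setI_eq0 dis cy.
  by rewrite cardsDS // F4 cx.
by rewrite setDDr setDv set0U setUC (setIidPr sx).
Qed.

Lemma transition_of_pair v (s : {set H}) : s \subset hes inc v -> #|s| = 2%N ->
  exists t, at_v v t /\ val t = [set s; hes inc v :\: s].
Proof.
move=> ss cs; pose P := [set s; hes inc v :\: s].
have cs' : #|hes inc v :\: s| = 2%N by rewrite cardsDS // F4 cs.
have /set0Pn[h hs] : s != set0 by rewrite -cards_eq0 cs.
have ne : s != hes inc v :\: s.
  by apply/eqP=> e; have := hs; rewrite e inE hs.
have tP : trans_at inc v P.
  apply/and3P; split; last first.
  - apply/forall_inP=> s'; rewrite !inE => /orP[] /eqP->; apply/andP;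
    by split; rewrite ?cs ?cs' //; apply/existsP; exists v; rewrite ?subsetDl.
  - by rewrite cards2 ne.
  apply/and3P; split.
  - by rewrite /cover bigcup_setU !big_set1 setDE setUIr setUCr setIT (setUidPr ss).
  - apply/trivIsetP=> A B; rewrite !inE.
    case/orP=> /eqP-> /orP[]/eqP->; rewrite ?eqxx // -setI_eq0 => _.
      by rewrite setIDA setIC -setIDA setDv setI0.
    by rewrite setIC setIDA setIC -setIDA setDv setI0.
  - by rewrite !inE negb_or !(eq_sym set0) -!cards_eq0 cs cs'.
have iP : is_transition inc P by apply/existsP; exists v.
by exists (exist _ P iP).
Qed.

Lemma two_transitions v : exists x y, [/\ at_v v x, at_v v y & x != y].
Proof.
have : (2 < #|hes inc v|)%N by rewrite F4.
case/card_gt2P=> a [b [c [[ha hb hc] [ab bc ca]]]].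
have sub p q : p \in hes inc v -> q \in hes inc v -> [set p; q] \subset hes inc v.
  by move=> hp hq; rewrite subUset !sub1set hp.
have [x [vx Ex]] := transition_of_pair (sub _ _ ha hb) ltac:(by rewrite cards2 ab).
have [y [vy Ey]] := transition_of_pair (sub _ _ ha hc) ltac:(by rewrite cards2 eq_sym ca).
exists x, y; split=> //; apply: contraNneq bc => xy.
have : [set a; b] \in val y by rewrite -xy Ex !inE eqxx.
rewrite Ey !inE => /orP[] /eqP/setP E.
  by have := E b; rewrite !inE eqxx orbT eq_sym (negPf ab).
by have := E a; rewrite !inE !eqxx.
Qed.

Lemma card_by_vertex S : #|S| = (\sum_v #|[set t in S | at_v v t]|)%N.
Proof.
rewrite -sum1_card.
have -> : (\sum_(t in S) 1 = \sum_(t in S) \sum_v (at_v v t : nat))%N.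
  apply: eq_bigr => t _; have [v tv] := at_v_exists t.
  rewrite (bigD1 v) //= tv big1 // => w wv.
  by case: (boolP (at_v w t)) => // /at_v_inj/(_ tv) e; rewrite e eqxx in wv.
rewrite exchange_big; apply: eq_bigr => v _ /=.
rewrite -sum1_card big_mkcond [RHS]big_mkcond /=; apply: eq_bigr => t _.
by rewrite inE; case: (t \in S) => //=; case: at_v.
Qed.

Lemma transv_sub T : transv T -> subtransv T.
Proof. by move=> /forallP tT; apply/forallP=> v; rewrite (eqP (tT v)). Qed.

Lemma subtransv_uniq S v x y : subtransv S -> x \in S -> y \in S ->
  at_v v x -> at_v v y -> x = y.
Proof.
move=> /forallP/(_ v)/card_le1_eqP e xS yS xv yv.
by apply: e; rewrite inE ?xS ?yS.
Qed.

Lemma transv_ex T v : transv T -> exists2 t, t \in T & at_v v t.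
Proof.
move=> /forallP/(_ v)/cards1P[t /setP/(_ t)]; rewrite !inE eqxx => /andP[]; by exists t.
Qed.

Lemma card_transv T : transv T -> #|T| = #|V|.
Proof.
by move=> /forallP tT; rewrite card_by_vertex -sum1_card; apply: eq_bigr => v _; apply/eqP.
Qed.

Lemma subtransvU1 S v x : subtransv S -> [set t in S | at_v v t] = set0 ->
  at_v v x -> subtransv (x |: S).
Proof.
move=> /forallP tS Sv xv; apply/forallP=> w; apply/card_le1_eqP=> y z.
rewrite !inE => /andP[/orP[/eqP->|yS] yw] /andP[/orP[/eqP->|zS] zw] //.
- by move/setP/(_ z): Sv; rewrite (at_v_inj xv yw) !inE zS zw.
- by move/setP/(_ y): Sv; rewrite (at_v_inj xv zw) !inE yS yw.
by apply: (card_le1_eqP (tS w)); rewrite inE ?yS ?zS.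
Qed.

(** At each vertex not yet met, nondegeneracy offers a transition that raises the rank. *)
Lemma multimatroid_extend (r : {set transition inc} -> nat) S :
  multimatroid r -> subtransv S ->
  exists T, [/\ transv T, S \subset T & (r S + (#|V| - #|S|) <= r T)%N].
Proof.
case=> _ nd; have [n] := ubnP (#|V| - #|S|); elim: n S => // n IHn S ltn tS.
have [trS|/forallPn[v nv]] := boolP (transv S).
  by exists S; rewrite (card_transv trS) subnn addn0.
have Sv : [set t in S | at_v v t] = set0.
  by apply/eqP; rewrite -cards_eq0; move/forallP/(_ v): tS nv; case: #|_| => [|[]].
have [x [y [xv yv xy]]] := two_transitions v.
have [z [zv rz]] : exists z, at_v v z /\ (r S < r (z |: S))%N.
  by have := nd _ _ _ _ tS Sv xv yv xy; rewrite leq_max => /orP[]; [exists x | exists y].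
have zS : z \notin S by apply/negP=> zS; move/setP/(_ z): Sv; rewrite !inE zS zv.
have tz := subtransvU1 tS Sv zv.
have : (#|z |: S| <= #|V|)%N.
  rewrite card_by_vertex -[#|V|]sum1_card; apply: leq_sum => w _; exact: (forallP tz).
rewrite cardsU1 zS add1n => cz.
have [|T [tT sT rT]] := IHn _ _ tz; first by rewrite cardsU1 zS add1n subnSK.
exists T; split=> //; first exact: subset_trans (subsetUr _ _) sT.
apply: leq_trans rT.
by rewrite cardsU1 zS add1n -[X in (r S + X)%N]subnSK // addnS -addSn leq_add2r.
Qed.

Lemma multimatroid_le (r : {set transition inc} -> nat) S T :
  multimatroid r -> transv T -> S \subset T -> (r T <= r S + (#|V| - #|S|))%N.
Proof.
case=> mat _ tT sST; have [cardr [_ subm]] := mat T (transv_sub tT).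
have := subm S (T :\: S) sST (subsetDl _ _).
have -> : S :|: (T :\: S) = T by rewrite setDE setUIr setUCr setIT (setUidPr sST).
have := cardr (T :\: S) (subsetDl _ _).
rewrite cardsDS // (card_transv tT) => le1 le2.
by rewrite (leq_trans (leq_addr _ _) (leq_trans le2 _)) // leq_add2l.
Qed.

(** By the two preceding bounds, r(S) + |V| - |S| is the maximum of r(T) over the transversals T
    containing S. *)
Lemma multimatroid_unique (r r' : {set transition inc} -> nat) :
  multimatroid r -> multimatroid r' -> (forall T, transv T -> r T = r' T) ->
  forall S, subtransv S -> r S = r' S.
Proof.
move=> mr mr' e S tS.
have [T [tT sT rT]] := multimatroid_extend mr tS.
have [T' [tT' sT' rT']] := multimatroid_extend mr' tS.
have := multimatroid_le mr' tT sT; have := multimatroid_le mr tT' sT'.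
rewrite -(e T) // (e T') // => le1 le2; apply/eqP; rewrite eqn_leq.
rewrite -(leq_add2r (#|V| - #|S|)) (leq_trans rT le2) /=.
by rewrite -(leq_add2r (#|V| - #|S|)) (leq_trans rT' le1).
Qed.

End Transitions.

(** * Parity of sets of half-edges, and the choice of omitted edges *)

Section Parity.
Variables (V H : finType) (inc : H -> V) (opp : H -> H).
Hypotheses (opp_invol : involutive opp) (opp_nofix : forall h, opp h != h).
Hypothesis F4 : four_regular inc.

Lemma card_by_inc (A : {set H}) : #|A| = (\sum_v #|A :&: hes inc v|)%N.
Proof.
rewrite -sum1_card (partition_big inc predT) //=; apply: eq_bigr => v _.
by rewrite -sum1_card; apply: eq_bigl => h; rewrite !inE.
Qed.

(** A system of representatives of the edges; the enumeration only breaks the tie. *)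
Definition half : {set H} := [set h | (enum_rank h < enum_rank (opp h))%N].

Lemma opp_half h : (opp h \in half) = (h \notin half).
Proof.
rewrite !inE opp_invol -leqNgt ltn_neqAle; case: eqP => //= /val_inj/enum_rank_inj e.
by have := opp_nofix h; rewrite e eqxx.
Qed.

(** [opp] exchanges the parts of [A] inside and outside [half]. *)
Lemma card_opp_closed (A : {set H}) : (forall h, h \in A -> opp h \in A) ->
  #|A| = (#|A :&: half|).*2.
Proof.
move=> cA; have injo := can_inj opp_invol.
have cA' h : (opp h \in A) = (h \in A).
  by apply/idP/idP => /cA; rewrite ?opp_invol.
rewrite -(cardsID half A) -addnn; congr addn.
rewrite -(card_imset (mem (A :&: half)) injo); apply: eq_card => h; rewrite !inE.
have -> : (h \in opp @: (A :&: half)) = (opp h \in A :&: half).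
  by rewrite -{1}(opp_invol h) mem_imset.
by rewrite inE cA' opp_half andbC; congr (_ && ~~ _); rewrite inE.
Qed.

Lemma card_half : #|half| = (#|V|.*2)%N.
Proof.
have := @card_opp_closed setT (fun _ _ => in_setT _); rewrite setTI card_by_inc.
rewrite (eq_bigr (fun=> 4%N)) => [|v _]; last by rewrite setTI F4.
by rewrite sum_nat_const => e; apply: double_inj; rewrite -e -!muln2 -mulnA.
Qed.

Lemma vadj_sym : connect_sym (vadj inc opp).
Proof.
apply: sym_connect_sym => u w; apply/existsP/existsP=> -[h /andP[hu hw]];
by exists (opp h); rewrite opp_invol hu hw.
Qed.

(* One half-edge of each edge, except for one edge in each component: by parity
   of the level sets, compatibility along the remaining edges implies
   compatibility along the omitted ones. *)
Lemma exists_edge_selection : exists O : {set H},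
  (#|O| + ncomp_graph inc opp = #|V|.*2)%N /\
  forall (T : eqType) (z : H -> T),
    (forall o, o \in O -> z (opp o) = z o) ->
    (forall c v, ~~ odd #|[set h in hes inc v | z h == c]|) ->
    forall h, z (opp h) = z h.
Proof.
pose rt v := fingraph.root (vadj inc opp) v.
have rt_opp h : rt (inc (opp h)) = rt (inc h).
  apply/eqP; rewrite root_connect; last exact: vadj_sym.
  by apply/connect1/existsP; exists (opp h); rewrite opp_invol !eqxx.
have rtK v : rt (rt v) = rt v by apply: root_root; apply: vadj_sym.
have /fin_all_exists[h0 h0P] : forall v, exists h, h \in half /\ rt (inc h) = rt v.
  move=> v; have /card_gt0P[h] : (0 < #|hes inc v|)%N by rewrite F4.
  rewrite inE => /eqP hv; have [hh|hh] := boolP (h \in half).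
    by exists h; rewrite hv.
  by exists (opp h); rewrite opp_half rt_opp hv.
(* Applying [h0] to the root makes the omitted half-edge depend on the component only. *)
pose O := [set h in half | h != h0 (rt (inc h))].
exists O; split=> [|T z zO even].
  rewrite -card_half -(cardsID O half); congr addn.
    by apply: eq_card => h; rewrite !inE; case: (_ < _)%N.
  rewrite /ncomp_graph /n_comp_mem.
  rewrite -(card_in_imset (f := h0)) => [|u w]; last first.
    rewrite !inE !andbT => /eqP ru /eqP rw /(congr1 (fun h => rt (inc h))).
    by rewrite !(proj2 (h0P _)) /rt ru rw.
  apply: eq_card => h; rewrite inE [h \in O]inE negb_and negbK.
  apply/imsetP/andP=> [[v]|[hO hh]].
    rewrite inE andbT => /eqP rv ->; have [-> e] := h0P v.
    by rewrite e /rt rv eqxx.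
  exists (rt (inc h)); first by rewrite inE andbT; apply: roots_root; apply: vadj_sym.
  by move: hO; rewrite hh => /eqP.
have main h : h \in half -> z (opp h) = z h.
  move=> hh; have [hO|hO] := boolP (h \in O); first exact: zO.
  apply/eqP/negPn/negP => ne.
  have hE : h = h0 (rt (inc h)) by move: hO; rewrite inE hh /= negbK => /eqP.
  (* This level set within the component is even at each vertex. If [z] differed at [opp h],
     removing [h] would leave a set closed under [opp], so [A] would be odd. *)
  pose A := [set k | (z k == z h) && (rt (inc k) == rt (inc h))].
  have evenA : ~~ odd #|A|.
    rewrite card_by_inc (big_morph odd oddD (erefl _)); apply/negP.
    rewrite big1 // => v _; apply/negbTE; have [e|e] := eqVneq (rt v) (rt (inc h)).
      rewrite (_ : _ :&: _ = [set k in hes inc v | z k == z h]) //.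
      apply/setP=> k; rewrite !inE.
      by case: (eqVneq (inc k) v) => [->|]; rewrite ?e ?eqxx ?andbT ?andbF.
    rewrite (_ : _ :&: _ = set0) ?cards0 //; apply/setP=> k; rewrite !inE.
    by case: (eqVneq (inc k) v) => [->|]; rewrite ?(negPf e) ?andbF.
  have hA : h \in A by rewrite inE !eqxx.
  have closedD k : k \in A :\ h -> opp k \in A :\ h.
    rewrite !inE rt_opp => /and3P[kh zk rk]; rewrite rk andbT.
    have okh : opp k != h by apply: contra_neq ne => e; rewrite -(eqP zk) -e opp_invol.
    rewrite okh /= -(eqP zk).
    have inO j : j \in half -> j != h -> rt (inc j) == rt (inc h) -> j \in O.
      by move=> jh jne /eqP rj; rewrite inE jh rj -hE.
    have [kk|] := boolP (k \in half); first by rewrite zO ?inO.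
    by rewrite -opp_half => kk; rewrite -zO ?opp_invol ?inO ?rt_opp.
  by move: evenA; rewrite (cardsD1 h A) hA oddD (card_opp_closed closedD) odd_double.
move=> h; have [/main//|] := boolP (h \in half).
by rewrite -opp_half => /main; rewrite opp_invol.
Qed.

End Parity.

(** * Ranks of families of row vectors *)

Section RowFamily.
Variables (K : fieldType) (I : finType) (q : nat).
Implicit Types (w : I -> 'rV[K]_q) (S T : {set I}).

Definition rowfamily w S : 'M[K]_(#|S|, q) := \matrix_(i < #|S|) w (enum_val i).

Lemma mem_rowfamily w S i : i \in S -> (w i <= rowfamily w S)%MS.
Proof.
move=> iS; apply: (eq_row_sub (enum_rank_in iS i)).
by rewrite rowK enum_rankK_in.
Qed.

Lemma rowfamily_sub p w S (X : 'M_(p, q)) :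
  (forall i, i \in S -> (w i <= X)%MS) -> (rowfamily w S <= X)%MS.
Proof. by move=> h; apply/row_subP=> i; rewrite rowK h // enum_valP. Qed.

Lemma rowfamilyS w S T : S \subset T -> (rowfamily w S <= rowfamily w T)%MS.
Proof. by move=> /subsetP sST; apply: rowfamily_sub => i /sST; apply: mem_rowfamily. Qed.

(** The dimension formula for the sum and intersection of two row spaces; the rows in [S :&: T] span
    only a subspace of the intersection. *)
Lemma rank_rowfamily_submod w S T :
  (\rank (rowfamily w (S :|: T)) + \rank (rowfamily w (S :&: T)) <=
   \rank (rowfamily w S) + \rank (rowfamily w T))%N.
Proof.
rewrite -(mxrank_sum_cap (rowfamily w S)); apply: leq_add; apply: mxrankS.
  apply: rowfamily_sub => i; rewrite inE => /orP[] /(mem_rowfamily w)/submx_trans; apply.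
    exact: addsmxSl.
  exact: addsmxSr.
by rewrite sub_capmx !rowfamilyS ?subsetIl ?subsetIr.
Qed.

End RowFamily.

Lemma rowfamily_mul (K : fieldType) (I : finType) (q p : nat) (w : I -> 'rV[K]_q)
    (Q : 'M_(q, p)) (S : {set I}) :
  rowfamily w S *m Q = rowfamily (fun i => w i *m Q) S.
Proof. by apply/row_matrixP=> i; rewrite row_mul !rowK. Qed.

(** * Flows, vertex stars and transition functionals *)

Section Flows.
Variables (K : fieldType) (V H : finType) (inc : H -> V) (opp : H -> H).
Hypotheses (opp_invol : involutive opp) (opp_nofix : forall h, opp h != h).
Hypothesis F4 : four_regular inc.
Variable O : {set H}.
Hypothesis O_generates : forall (T : eqType) (z : H -> T),
  (forall o, o \in O -> z (opp o) = z o) ->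
  (forall c v, ~~ odd #|[set h in hes inc v | z h == c]|) ->
  forall h, z (opp h) = z h.
Implicit Types (S T : {set transition inc}) (t x y : transition inc) (v w : V).

(** Each column is the unit flow along one kept edge, as an antisymmetric function on half-edges.
    Acting on a row vector, the matrix takes differences across the kept edges. *)
Definition boundary : 'M[K]_(#|H|, #|O|) := \matrix_(i, j)
  ((enum_val i == enum_val j)%:R - (enum_val i == opp (enum_val j))%:R).

Definition indicator (s : {set H}) : 'rV[K]_#|H| := \row_j (enum_val j \in s)%:R.

Definition starmx : 'M[K]_(#|V|, #|H|) :=
  \matrix_(i < #|V|) indicator (hes inc (enum_val i)).

Definition blockmx S : 'M[K]_(#|S|, #|H|) :=
  rowfamily (fun t => indicator (block t)) S.

(** For a subtransversal, subtracting block rows from star rows and multiplying by [boundary] gives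
    the incidence matrix, on the kept edges, of the graph whose vertices met by [S] are split in
    two. *)
Definition splitmx S := col_mx starmx (blockmx S).

Lemma mul_boundary n (z : 'M[K]_(n, #|H|)) i (j : 'I_#|O|) :
  (z *m boundary) i j =
  z i (enum_rank (enum_val j)) - z i (enum_rank (opp (enum_val j))).
Proof.
rewrite mxE (eq_bigr (fun k => z i k * (k == enum_rank (enum_val j))%:R -
   z i k * (k == enum_rank (opp (enum_val j)))%:R)) => [|k _]; last first.
  by rewrite mxE mulrBr; congr (_ * _%:R - _ * _%:R); rewrite -(inj_eq enum_val_inj) enum_rankK.
have pick l : \sum_k z i k * (k == l)%:R = z i l.
  rewrite (bigD1 l) //= eqxx mulr1 big1 ?addr0 // => k /negPf->.
  by rewrite mulr0.
by rewrite sumrB !pick.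
Qed.

Lemma boundary_eq0 (z : 'rV[K]_#|H|) : z *m boundary = 0 <->
  forall o, o \in O -> z 0 (enum_rank (opp o)) = z 0 (enum_rank o).
Proof.
split=> [z0 o oO|zO].
  have := mul_boundary z 0 (enum_rank_in oO o); rewrite z0 mxE enum_rankK_in //.
  by move/esym/eqP; rewrite subr_eq0 => /eqP.
by apply/rowP=> j; rewrite mul_boundary zO ?enum_valP // subrr mxE.
Qed.

Lemma mul_starmx (x : 'rV[K]_#|V|) h :
  (x *m starmx) 0 (enum_rank h) = x 0 (enum_rank (inc h)).
Proof.
rewrite mxE (bigD1 (enum_rank (inc h))) //= !mxE !enum_rankK inE eqxx mulr1.
rewrite big1 ?addr0 // => i ni; rewrite !mxE enum_rankK inE.
case: eqP => [e|_]; last by rewrite mulr0.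
by rewrite e enum_valK eqxx in ni.
Qed.

(** The left kernel consists of the vertex functions constant on components: a level set has 0 or 4
    half-edges at each vertex, so equality across kept edges extends to the omitted ones. *)
Lemma rank_star : (\rank (starmx *m boundary) + ncomp_graph inc opp)%N = #|V|.
Proof.
apply: (@rank_components _ _ _ _ _ _ (1%:M)).
- exact: vadj_sym.
- by rewrite -row_leq_rank mxrank1.
- move=> x; rewrite mulmx1 mulmxA boundary_eq0; split=> [xO u w|cx o _].
    case/existsP=> h /andP[/eqP <- /eqP <-]; rewrite -!mul_starmx.
    apply/esym/(@O_generates _ (fun h => (x *m starmx) 0 (enum_rank h))) => // c v.
    have [e|e] := eqVneq (x 0 (enum_rank v)) c.
      rewrite (_ : [set _ in _ | _] = hes inc v) ?F4 //; apply/setP=> k.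
      by rewrite !inE mul_starmx; case: eqP => //= ->; rewrite e eqxx.
    rewrite (_ : [set _ in _ | _] = set0) ?cards0 //; apply/setP=> k.
    by rewrite !inE mul_starmx; case: eqP => //= ->; rewrite (negPf e).
  rewrite !mul_starmx; apply/esym/cx/existsP; exists o; by rewrite !eqxx.
- by move=> z _; apply: submx1.
Qed.

(** * Functions compatible with the splitting of vertices *)

Definition covered S : {set H} := [set h | [exists t in S, h \in block t]].

Lemma mem_covered S t h : subtransv S -> t \in S -> at_v (inc h) t ->
  (h \in covered S) = (h \in block t).
Proof.
move=> tS tin hv; rewrite inE; apply/exists_inP/idP=> [[t' t'S ht']|ht]; last by exists t.
by rewrite (subtransv_uniq tS tin t'S hv (block_at ht')).
Qed.

Lemma covered_none S h : [set t in S | at_v (inc h) t] = set0 -> h \notin covered S.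
Proof.
move=> S0; rewrite inE; apply/exists_inP=> -[t tS /block_at th].
by move/setP/(_ t): S0; rewrite !inE tS th.
Qed.

Lemma subtransv_at S v : subtransv S ->
  [set t in S | at_v v t] = set0 \/ exists2 t, t \in S & at_v v t.
Proof.
move=> tS; have [->|[t]] := set_0Vmem [set t in S | at_v v t]; first by left.
by rewrite inE => /andP[tin tv]; right; exists t.
Qed.

(** For a subtransversal: [z] is constant on each single transition at a vertex met by [S], and on
    the whole star elsewhere. *)
Definition respects S v (T : Type) (z : H -> T) := forall h k,
  inc h = v -> inc k = v -> (h \in covered S) = (k \in covered S) -> z h = z k.

(** The set is a union of sides of the split at [v], whose sizes are 2 and 2, or 0 and 4. *)
Lemma respects_even S v (z : H -> bool) : subtransv S -> respects S v z ->
  ~~ odd #|[set h in hes inc v | z h]|.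
Proof.
move=> tS rz; set A := [set h in _ | _]; set D := hes inc v :&: covered S.
have evD : ~~ odd #|D|.
  have [Sv|[t tin tv]] := subtransv_at v tS.
    rewrite (_ : D = set0) ?cards0 //; apply/setP=> h; rewrite !inE.
    case: eqP => //= hv; apply/negbTE.
    by have := @covered_none S h; rewrite hv inE; apply.
  have [sb cb _] := at_v_blocks tv.
  rewrite (_ : D = block t) ?cb //; apply/setP=> h; rewrite in_setI.
  have [hh|hh] := boolP (h \in hes inc v).
    by rewrite (@mem_covered _ t) //; move: hh; rewrite inE => /eqP->.
  by apply/esym/negP=> /(subsetP sb); apply/negP.
have evC : ~~ odd #|hes inc v :\: D|.
  by rewrite cardsDS ?subsetIl // F4 oddB ?F4 // -(F4 v) subset_leq_card ?subsetIl.
have part (E : {set H}) : E \subset hes inc v -> ~~ odd #|E| ->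
    (forall h k, h \in E -> k \in E -> z h = z k) -> ~~ odd #|A :&: E|.
  move=> /subsetP sE evE cE; have [->|[h]] := set_0Vmem (A :&: E); first by rewrite cards0.
  rewrite !inE => /andP[/andP[_ zh] hE]; rewrite (_ : A :&: E = E) //.
  by apply/setP=> k; rewrite !inE; case: (boolP (k \in E)) => [kE|]; rewrite ?andbF //
     -(cE _ _ hE kE) zh; move: (sE _ kE); rewrite inE => ->.
rewrite -(cardsID D A) oddD negb_add.
have -> : A :\: D = A :&: (hes inc v :\: D).
  apply/setP=> h; rewrite !inE.
  by case: (inc h == v); case: (z h); rewrite /= ?andbT ?andbF.
have /negPf-> : ~~ odd #|A :&: D|.
  apply: (part D _ evD) => [|h k]; first exact: subsetIl.
  by rewrite !inE => /andP[/eqP hv hc] /andP[/eqP kv kc]; apply: rz => //; rewrite !inE hc kc.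
have /negPf-> // : ~~ odd #|A :&: (hes inc v :\: D)|.
apply: (part _ _ evC) => [|h k]; first exact: subsetDl.
rewrite in_setD in_setI => /andP[hc hv]; rewrite in_setD in_setI => /andP[kc kv].
rewrite hv /= in hc; rewrite kv /= in kc; move: hv kv; rewrite !inE => /eqP hv /eqP kv.
by apply: rz => //; rewrite (negPf hc) (negPf kc).
Qed.

Lemma respects_level S v (T : eqType) (z : H -> T) c :
  subtransv S -> respects S v z -> ~~ odd #|[set h in hes inc v | z h == c]|.
Proof.
by move=> tS rz; apply: respects_even tS _ => h k hv kv /(rz _ _ hv kv)->.
Qed.

Section Splitting.
Variables (S : {set transition inc}) (u : 'rV[K]_(#|V| + #|S|)).
Hypothesis tS : subtransv S.

(** The left part of [u] gives a value at each vertex, the right part an offset on each block. *)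
Definition split_fun h := (u *m splitmx S) 0 (enum_rank h).

Lemma split_funE h : split_fun h = lsubmx u 0 (enum_rank (inc h)) +
  \sum_(j < #|S|) rsubmx u 0 j * (h \in block (enum_val j))%:R.
Proof.
rewrite /split_fun /splitmx -{1}(hsubmxK u) mul_row_col mxE mul_starmx.
by congr (_ + _); rewrite mxE; apply: eq_bigr => j _; rewrite !mxE enum_rankK.
Qed.

Lemma split_fun_out h : h \notin covered S ->
  split_fun h = lsubmx u 0 (enum_rank (inc h)).
Proof.
move=> hS; rewrite split_funE big1 ?addr0 // => j _.
case: (boolP (h \in block _)) => [hj|_]; last by rewrite mulr0.
by case/negP: hS; rewrite inE; apply/exists_inP; exists (enum_val j); rewrite ?enum_valP.
Qed.

Lemma split_fun_in h (j : 'I_#|S|) : h \in block (enum_val j) ->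
  split_fun h = lsubmx u 0 (enum_rank (inc h)) + rsubmx u 0 j.
Proof.
move=> hj; rewrite split_funE (bigD1 j) //= hj mulr1 big1 ?addr0 // => i ij.
case: (boolP (h \in block _)) => [hi|_]; last by rewrite mulr0.
case/eqP: ij; apply: enum_val_inj.
exact: (subtransv_uniq tS (enum_valP i) (enum_valP j) (block_at hi) (block_at hj)).
Qed.

Lemma split_fun_respects v : respects S v split_fun.
Proof.
move=> h k hv kv e; have [hS|hS] := boolP (h \in covered S); last first.
  by rewrite !split_fun_out ?hv ?kv -?e.
rewrite hS in e; move: hS e; rewrite inE => /exists_inP[t tin ht] /esym.
have tv := block_at ht; rewrite hv -kv in tv; rewrite (mem_covered tS tin tv) => kt.
rewrite -(enum_rankK_in tin tin) in ht kt.
by rewrite (split_fun_in ht) (split_fun_in kt) hv kv.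
Qed.

End Splitting.

(** * Transversals and the number of circuits *)

Section Transversal.
Variable T : {set transition inc}.
Hypothesis tT : transv T.
Let sT : subtransv T := transv_sub tT.

Lemma circ_rel_same t v h k : t \in T -> at_v v t -> inc h = v -> inc k = v ->
  (h \in block t) = (k \in block t) -> h = k \/ circ_rel opp T h k.
Proof.
move=> tin tv hv kv e; have [->|ne] := eqVneq h k; [by left | right].
have [sb cb Et] := at_v_blocks tv.
have cd : #|hes inc v :\: block t| = 2%N by rewrite cardsDS // F4 cb.
rewrite /circ_rel; apply/orP; right; apply/exists_inP; exists t => //; rewrite Et.
have [ht|ht] := boolP (h \in block t).
  rewrite (_ : [set h; k] = block t) ?set21 //; apply/eqP.
  by rewrite eqEcard cards2 ne cb subUset !sub1set -e ht.
rewrite (_ : [set h; k] = hes inc v :\: block t) ?set22 //; apply/eqP.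
by rewrite eqEcard cards2 ne cd subUset !sub1set !inE -e ht hv kv eqxx.
Qed.

Lemma circ_rel_sym : connect_sym (circ_rel opp T).
Proof.
apply: sym_connect_sym => h k; rewrite /circ_rel [[set h; k]]setUC; congr (_ || _).
by apply/eqP/eqP => <-.
Qed.

Lemma circ_rel_transition t h k : t \in T -> [set h; k] \in val t ->
  inc h = inc k /\ (h \in covered T) = (k \in covered T).
Proof.
move=> tin; have [v tv] := at_v_exists t; have [sb _ Et] := at_v_blocks tv.
have cov p : inc p = v -> (p \in covered T) = (p \in block t).
  by move=> pv; apply: mem_covered; rewrite ?pv.
rewrite Et in_set2 => /orP[] /eqP E.
  have /andP[ht kt] : (h \in block t) && (k \in block t) by rewrite -E !inE !eqxx orbT.
  have hv := block_inc tv ht; have kv := block_inc tv kt.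
  by rewrite !cov // ht kt hv kv.
have /andP[] : (h \in hes inc v :\: block t) && (k \in hes inc v :\: block t).
  by rewrite -E !inE !eqxx orbT.
rewrite !in_setD ![_ \in hes _ _]inE => /andP[ht /eqP hv] /andP[kt /eqP kv].
by rewrite !cov // (negPf ht) (negPf kt) hv kv.
Qed.

Lemma uncovered v : exists h, inc h = v /\ h \notin covered T.
Proof.
have [t tin tv] := transv_ex v tT; have [sb cb _] := at_v_blocks tv.
have /card_gt0P[h] : (0 < #|hes inc v :\: block t|)%N by rewrite cardsDS // F4 cb.
rewrite !inE => /andP[ht /eqP hv]; exists h; split=> //.
by rewrite (@mem_covered _ t) ?hv.
Qed.

Lemma block_nonempty t : exists h, h \in block t.
Proof.
have [v /at_v_blocks[_ cb _]] := at_v_exists t.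
by apply/card_gt0P; rewrite cb.
Qed.

(** An uncovered half-edge at each vertex reads off the vertex value; any half-edge of a block then
    reads off the offset. *)
Lemma splitmx_free : row_free (splitmx T).
Proof.
apply: inj_row_free => u u0.
have s0 h : split_fun u h = 0 by rewrite /split_fun u0 mxE.
have l0 v : lsubmx u 0 (enum_rank v) = 0.
  by have [h [<- hT]] := uncovered v; rewrite -(split_fun_out u hT).
have lu : lsubmx u = 0 by apply/rowP=> i; rewrite -(enum_valK i) l0 mxE.
have ru : rsubmx u = 0.
  apply/rowP=> j; rewrite [RHS]mxE; have [h hj] := block_nonempty (enum_val j).
  by have := split_fun_in u sT hj; rewrite s0 l0 add0r => <-.
by rewrite -(hsubmxK u) lu ru row_mx0.
Qed.

(** The left kernel corresponds to the functions on half-edges constant on circuits: single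
    transitions are respected by construction, and omitted edges by parity. *)
Lemma rank_split :
  (\rank (splitmx T *m boundary) + ncircuits opp T)%N = (#|V| + #|T|)%N.
Proof.
apply: (@rank_components _ _ _ _ _ _ (splitmx T)).
- exact: circ_rel_sym.
- exact: splitmx_free.
- move=> u; rewrite mulmxA boundary_eq0; split=> [uO h k|cu o _]; last first.
    by apply/esym/cu; rewrite /circ_rel eqxx.
  case/orP=> [/eqP <-|/exists_inP[t tin /(circ_rel_transition tin)[e1 e2]]].
    apply/esym/(@O_generates _ (split_fun u)) => // c v.
    exact/respects_level/split_fun_respects.
  exact: (split_fun_respects u sT e1 (erefl _) e2).
- move=> z cz.
  have cz' t h k : t \in T -> at_v (inc k) t -> inc h = inc k ->
      (h \in block t) = (k \in block t) -> z 0 (enum_rank h) = z 0 (enum_rank k).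
    move=> tin tv hv e.
    by case: (circ_rel_same tin tv hv (erefl _) e) => [->|/cz].
  have /fin_all_exists[out outP] := uncovered.
  have /fin_all_exists[inn innP] := block_nonempty.
  (* Vertex values are sampled outside the blocks; offsets are the jumps from there into the
     blocks. *)
  pose u := row_mx (\row_(i < #|V|) z 0 (enum_rank (out (enum_val i))))
    (\row_(j < #|T|) (z 0 (enum_rank (inn (enum_val j))) -
       z 0 (enum_rank (out (inc (inn (enum_val j))))))).
  suff -> : z = u *m splitmx T by apply: submxMl.
  apply/rowP=> i; rewrite -(enum_valK i); move: (enum_val i) => h.
  rewrite -/(split_fun u h); have [t tin tv] := transv_ex (inc h) tT.
  have [hT|hT] := boolP (h \in block t).
    rewrite -{1}(enum_rankK_in tin tin) in hT; rewrite (split_fun_in _ sT hT).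
    rewrite /u row_mxKl row_mxKr !mxE !enum_rankK (enum_rankK_in tin tin).
    rewrite (enum_rankK_in tin tin) in hT.
    have it := block_inc tv (innP t).
    rewrite it addrC subrK; apply: (cz' t); rewrite ?it //.
    by rewrite hT innP.
  have hU : h \notin covered T by rewrite (@mem_covered _ t).
  rewrite (split_fun_out _ hU) /u row_mxKl !mxE enum_rankK.
  have [oi oT] := outP (inc h).
  apply: (cz' t); rewrite ?oi //.
  by rewrite -!(@mem_covered T) ?oi // (negPf oT) (negPf hU).
Qed.

End Transversal.

(** * Minors on a subtransversal *)

(** Removing the chosen blocks from the chosen stars is a unimodular row operation that makes the
    row supports disjoint, so [det_network] applies. *)
Lemma minors_split T r k (f : 'I_r -> 'I_#|V|) (f' : 'I_k -> 'I_#|T|)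
    (g : 'I_(r + k) -> 'I_#|O|) :
  subtransv T -> injective f -> injective f' ->
  let d := \det (colsub g (col_mx (rowsub f (starmx *m boundary))
                                  (rowsub f' (blockmx T *m boundary)))) in
  d ^+ 3 = d.
Proof.
move=> tT injf injf'.
pose b (j : 'I_k) := block (enum_val (f' j)).
pose B := \bigcup_j b j.
pose s (i : 'I_(r + k)) := match split i with
  | inl i => hes inc (enum_val (f i)) :\: B | inr j => b j end.
have disb h i j : h \in b i -> h \in b j -> i = j.
  move=> hi hj; apply/injf'/enum_val_inj.
  exact: (subtransv_uniq tT (enum_valP _) (enum_valP _) (block_at hi) (block_at hj)).
(* [L] puts each chosen block back into the star of its vertex. *)
pose L : 'M[K]_(r, k) := \matrix_(i, j) (at_v (enum_val (f i)) (enum_val (f' j)))%:R.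
pose Y : 'M[K]_(r + k, #|H|) := \matrix_i indicator (s i).
have -> : col_mx (rowsub f (starmx *m boundary)) (rowsub f' (blockmx T *m boundary)) =
    block_mx 1%:M L 0 1%:M *m Y *m boundary.
  rewrite -!mul_rowsub_mx -mul_col_mx; congr (_ *m _).
  rewrite -[Y]vsubmxK mul_block_col !mul1mx mul0mx add0r; congr col_mx.
    apply/matrixP=> i l; rewrite !mxE /s (unsplitK (inl _)) !inE.
    set h := enum_val l.
    rewrite (eq_bigr (fun j => (at_v (enum_val (f i)) (enum_val (f' j)))%:R * (h \in b j)%:R));
      last by move=> j _; rewrite !mxE /s (unsplitK (inr _)).
    have [hB|hB] := boolP (h \in B); rewrite /= ?add0r.
      have [j _ hj] := bigcupP hB.
      rewrite (bigD1 j) //= hj mulr1 big1 ?addr0 => [|j' ne]; last first.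
        case: (boolP (h \in b j')) => [hj'|_]; last by rewrite mulr0.
        by rewrite (disb _ _ _ hj hj') eqxx in ne.
      suff -> : (inc h == enum_val (f i)) = at_v (enum_val (f i)) (enum_val (f' j)) by [].
      by apply/eqP/idP => [<-|/(at_v_inj (block_at hj))//]; apply: block_at.
    rewrite big1 ?addr0 // => j _; case: (boolP (h \in b j)) => [hj|_]; last by rewrite mulr0.
    by case/negP: hB; apply/bigcupP; exists j.
  by apply/matrixP=> j l; rewrite !mxE /s (unsplitK (inr _)).
rewrite -mulmxA -mulmx_colsub det_mulmx det_ublock !det1 !mul1r.
have -> : colsub g (Y *m boundary) = \matrix_(i, j)
    ((enum_val (g j) \in s i)%:R - (opp (enum_val (g j)) \in s i)%:R).
  by apply/matrixP=> i j; rewrite mxE mul_boundary !mxE !enum_rankK.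
apply: det_network => h i i'; rewrite /s -{2}[i]splitK -{2}[i']splitK.
case: (split i) => j; case: (split i') => j' /=.
- rewrite !inE => /andP[_ /eqP e] /andP[_ /eqP e'].
  by congr lshift; apply/injf/enum_val_inj; rewrite -e -e'.
- by rewrite inE => /andP[/negP hB _] hj; case: hB; apply/bigcupP; exists j'.
- by move=> hj; rewrite inE => /andP[/negP hB _]; case: hB; apply/bigcupP; exists j.
by move=> hj hj'; rewrite (disb _ _ _ hj hj').
Qed.

(** * Nondegeneracy *)

(** A linear dependence makes the indicator of [block x] minus some [split_fun] equal across kept
    edges. As [S] does not split [v], only the indicator varies there. *)
Lemma split_fun_separating S v x : subtransv S -> [set t in S | at_v v t] = set0 ->
  at_v v x -> (indicator (block x) *m boundary <= splitmx S *m boundary)%MS ->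
  exists z : H -> K, [/\ forall h, z (opp h) = z h,
    forall w, w != v -> respects S w z &
    forall h k, inc h = v -> inc k = v ->
      (z h == z k) = ((h \in block x) == (k \in block x))].
Proof.
move=> tS Sv xv /submxP[u]; rewrite mulmxA => E.
pose z h : K := (h \in block x)%:R - split_fun u h.
have outv h : inc h = v -> h \notin covered S.
  by move=> hv; apply: covered_none; rewrite hv.
have zv h k : inc h = v -> inc k = v -> (z h == z k) = ((h \in block x) == (k \in block x)).
  move=> hv kv; rewrite /z (split_fun_respects u tS hv kv) ?(negPf (outv _ _)) //.
  rewrite (inj_eq (addIr _)).
  by case: (h \in _); case: (k \in _); rewrite ?eqxx ?oner_eq0 // eq_sym oner_eq0.
have zw w : w != v -> respects S w z.
  move=> wv h k hw kw e; have nb p : inc p = w -> p \in block x = false.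
    by move=> pw; apply/negP=> /(block_inc xv) pv; rewrite -pw pv eqxx in wv.
  by rewrite /z !nb // (split_fun_respects u tS hw kw e).
exists z; split=> // h; apply: (@O_generates _ z) => {h} [o oO|c w].
  have /boundary_eq0/(_ o oO) : (indicator (block x) - u *m splitmx S) *m boundary = 0.
    by rewrite mulmxBl E subrr.
  have zE p : (indicator (block x) - u *m splitmx S) 0 (enum_rank p) = z p.
    by rewrite [LHS]mxE [X in X + _]mxE [X in _ + X]mxE enum_rankK.
  by rewrite !zE.
(* Level sets are even at [v] as well because [z] respects the larger set [x |: S] at every
   vertex. *)
apply: (respects_level c (subtransvU1 tS Sv xv)) => h k hw kw.
have cov p : (p \in covered (x |: S)) = (p \in block x) || (p \in covered S).
  rewrite !inE; apply/exists_inP/orP => [[t]|[px|/exists_inP[t tin pt]]].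
  - by rewrite !inE => /orP[/eqP->|tin pt]; [left | right; apply/exists_inP; exists t].
  - by exists x; rewrite ?setU11.
  - by exists t; rewrite ?setU1r.
rewrite !cov; have [wv|wv] := eqVneq w v; last first.
  have nb p : inc p = w -> p \in block x = false.
    by move=> pw; apply/negP=> /(block_inc xv) pv; rewrite -pw pv eqxx in wv.
  by rewrite !nb //; apply: (zw w).
rewrite wv in hw kw; rewrite (negPf (outv _ hw)) (negPf (outv _ kw)) !orbF => e.
by apply/eqP; rewrite zv // e.
Qed.

(* The common level set of the two separating functions is closed under [opp],
   hence even, but it meets [v] in the single half-edge of
   [block x :&: block y] and every other vertex in an even number. *)
Lemma split_nondegenerate S v x y : subtransv S -> [set t in S | at_v v t] = set0 ->
  at_v v x -> at_v v y -> x != y ->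
  ~~ ((indicator (block x) *m boundary <= splitmx S *m boundary)%MS &&
      (indicator (block y) *m boundary <= splitmx S *m boundary)%MS).
Proof.
move=> tS Sv xv yv xy; apply/negP=> /andP[].
move=> /(split_fun_separating tS Sv xv)[zx [zxo zxw zxv]].
move=> /(split_fun_separating tS Sv yv)[zy [zyo zyw zyv]].
have /eqP/cards1P[a aE] := card_blockI F4 xv yv xy.
have /setIP[ax ay] : a \in block x :&: block y by rewrite aE set11.
have av := block_inc xv ax.
pose A := [set h | (zx h == zx a) && (zy h == zy a)].
have /(card_opp_closed opp_invol opp_nofix)/(congr1 odd) h : forall h, h \in A -> opp h \in A.
  by move=> h; rewrite !inE zxo zyo.
move: h; rewrite odd_double (card_by_inc inc A) (bigD1 v) //= oddD.
have -> : A :&: hes inc v = [set a].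
  rewrite -aE; apply/setP=> h; rewrite in_setI [h \in A]inE [h \in hes _ _]inE in_setI.
  case: (eqVneq (inc h) v) => [hv|hv]; last first.
    by rewrite andbF; apply/esym/negP=> /andP[/(block_inc xv)] e; rewrite e eqxx in hv.
  by rewrite zxv // zyv // ax ay !eqb_id andbT.
rewrite cards1 (big_morph odd oddD (erefl _)) big1 // => w wv; apply/negbTE.
rewrite (_ : _ :&: _ = [set h in hes inc w | (zx h == zx a) && (zy h == zy a)]).
  apply: (respects_even tS) => h k hw kw e.
  by rewrite (zxw _ wv _ _ hw kw e) (zyw _ wv _ _ hw kw e).
by apply/setP=> h; rewrite !inE andbC.
Qed.

(** * The representation of the Eulerian 3-matroid *)

(** The vectors are the block rows modulo the stars, so ranks are differences of ranks; for a
    transversal with circuit partition P this is (2|V| - |P|) - (|V| - c(F)). *)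
Lemma flow_representation :
  (#|O| + ncomp_graph inc opp = #|V|.*2)%N ->
  exists w : transition inc -> 'rV[K]_#|O|,
  [/\ multimatroid (fun S => \rank (rowfamily w S)),
      forall T, transv T ->
        (\rank (rowfamily w T) + ncircuits opp T = #|V| + ncomp_graph inc opp)%N,
      forall S, (\rank (rowfamily w S) <= #|V|)%N &
      forall T, transv T -> forall k (f : 'I_k -> 'I_#|T|) (g : 'I_k -> 'I_#|O|),
        injective f -> let d := \det (mxsub f g (rowfamily w T)) in d ^+ 3 = d].
Proof.
move=> cardO.
have [Q [rankQ detQ]] := schur_projection (starmx *m boundary).
pose w t := indicator (block t) *m boundary *m Q; exists w.
have wE S : rowfamily w S = blockmx S *m boundary *m Q.
  by rewrite /blockmx !rowfamily_mul.
have rS S : (\rank (rowfamily w S) + \rank (starmx *m boundary) =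
    \rank (splitmx S *m boundary))%N.
  by rewrite wE rankQ -mul_col_mx.
split.
- split=> [S _|S v x y tS Sv xv yv xy].
    split; first by move=> A _; apply: rank_leq_row.
    split=> [A B sAB _|A B _ _]; first exact/mxrankS/rowfamilyS.
    exact: rank_rowfamily_submod.
  (* An unchanged rank puts the added block row into the span of the stars and earlier blocks. *)
  rewrite ltnNge geq_max; apply: contra (split_nondegenerate tS Sv xv yv xy).
  have sub t : (\rank (rowfamily w (t |: S)) <= \rank (rowfamily w S))%N ->
      (indicator (block t) *m boundary <= splitmx S *m boundary)%MS.
    rewrite -(leq_add2r (\rank (starmx *m boundary))) !rS => le.
    have s1 : (splitmx S *m boundary <= splitmx (t |: S) *m boundary)%MS.
      by rewrite submxMr // /splitmx -!addsmxE addsmxS ?rowfamilyS ?subsetUr.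
    rewrite (geq_leqif (mxrank_leqif_sup s1)) in le; apply: submx_trans le.
    rewrite submxMr // /splitmx -addsmxE (submx_trans _ (addsmxSr _ _)) //.
    exact: (mem_rowfamily (fun t => indicator (block t))) (setU11 _ _).
  by case/andP=> /sub-> /sub->.
- move=> T tT; move: (rS T) (rank_split tT) rank_star.
  by move: (card_transv tT); lia.
(* There are 2|V| - c(F) columns, and the stars use up rank |V| - c(F). *)
- by move=> S; move: (rS S) (rank_leq_col (splitmx S *m boundary)) rank_star cardO; lia.
- move=> T tT k f g injf; rewrite wE; apply: detQ => // r k' f1 f2 g1 i1 i2.
  exact: minors_split (transv_sub tT) i1 i2.
Qed.

End Flows.
Theorem mainTheorem14 (V H : finType) (inc : H -> V) (opp : H -> H)
  (opp_invol : involutive opp) (opp_nofix : forall h, opp h != h)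
  (F4 : four_regular inc) :
  (exists r, is_eulerian_3matroid inc opp r) /\
  (forall r, is_eulerian_3matroid inc opp r ->
    exists (m : nat) (M : 'I_m -> transition inc -> R),
      (* representation *)
      (forall S, subtransv S -> \rank (colmx M S) = r S) /\
      (* strict *)
      \rank (colmx M setT) = \max_(S | subtransv S) r S /\
      (* totally transversally unimodular *)
      (forall T, transv T -> totally_unimodular (colmx M T))).
Proof.
have [O [cardO genO]] := exists_edge_selection opp_invol opp_nofix F4.
have [w [mat_w circ_w le_w det_w]] :=
  flow_representation R opp_invol opp_nofix F4 genO cardO.
split=> [|r [mat_r circ_r]].
  exists (fun S => \rank (rowfamily w S)); split=> // T /circ_w; lia.
(* By uniqueness it suffices to represent the multimatroid built from flows. *)
have rE S : subtransv S -> r S = \rank (rowfamily w S).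
  apply: (multimatroid_unique F4 mat_r mat_w) => T tT.
  by move: (circ_r T tT) (circ_w T tT); lia.
pose M (i : 'I_#|O|) t := w t 0 i.
have colM S : colmx M S = (rowfamily w S)^T by apply/matrixP=> i j; rewrite !mxE.
exists #|O|, M; split=> [S tS|]; first by rewrite colM mxrank_tr rE.
split=> [|T tT k f g injf injg d].
  rewrite colM mxrank_tr; apply/eqP; rewrite eqn_leq; apply/andP; split.
    (* Extending the empty set gives a transversal of rank at least |V|, the bound on the whole
       matrix. *)
    have t0 : subtransv (set0 : {set transition inc}).
      apply/forallP=> v; rewrite (_ : [set t in _ | _] = set0) ?cards0 //.
      by apply/setP=> t; rewrite !inE.
    have [T [tT _ le]] := multimatroid_extend F4 mat_r t0.
    apply: leq_trans (le_w _) (leq_trans _ (leq_bigmax_cond _ (transv_sub tT))).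
    by apply: leq_trans le; rewrite cards0 subn0 leq_addl.
  by apply/bigmax_leqP=> S tS; rewrite rE // mxrankS ?rowfamilyS ?subsetT.
apply: cube_eq_self.
have -> : d = \det (mxsub g f (rowfamily w T)).
  by rewrite -det_tr /d; congr (\det _); apply/matrixP=> i j; rewrite colM !mxE.
exact: det_w.
Qed.
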